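(* Let $H$ be a graph of order $n_2$ and let $n_1\ge 2$. Then for every integer $k$ with $2\le k\le n_1$, $$\chi_{\le k}(P_{n_1}\odot H)=\begin{cases} n_2(k-1)+k+1, & \text{if } k\le n_1-1,\\ n_2(k-1)+k, & \text{if } k=n_1.\end{cases}$$
   Context: All graphs are finite, undirected, without loops or multiple edges. The order of a graph is its number of vertices. $P_n$ denotes the path on $n$ vertices. For graphs $G$ and $H$, where $G$ has vertices $v_1,\dots,v_{n_1}$, the corona graph $G\odot H$ is obtained from one copy of $G$ and $n_1$ copies of $H$ by joining by an edge each vertex of the $i$-th copy of $H$ with the vertex $v_i$ of $G$. A distance-$k$ coloring of a graph is an assignment of colors to its vertices such that any two different vertices at distance at most $k$ receive different colors; $\chi_{\le k}(G)$ denotes the minimum number of colors in a distance-$k$ coloring of $G$. *)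

(* Defs.v *)
From mathcomp Require Import all_boot.

Set Implicit Arguments.
Unset Strict Implicit.
Unset Printing Implicit Defensive.

Record sgraph := SGraph {
  vertex :> finType;
  adj : rel vertex;
  adj_sym : symmetric adj;
  adj_irrefl : irreflexive adj }.

Section PathGraph.
Variable n : nat.

Definition path_adj : rel 'I_n := fun i j => (i.+1 == j) || (j.+1 == i).

Lemma path_adj_sym : symmetric path_adj.
Proof. by move=> i j; rewrite /path_adj orbC. Qed.

Lemma path_adj_irrefl : irreflexive path_adj.
Proof. by move=> i; rewrite /path_adj orbb gtn_eqF. Qed.

Definition path_graph : sgraph := SGraph path_adj_sym path_adj_irrefl.

End PathGraph.

Section Corona.
Variables G H : sgraph.

(* [inl v] is the vertex v of G; [inr (v, x)] is the vertex x of the copy of H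
   attached to v. *)
Definition corona_adj : rel (G + G * H)%type := fun a b =>
  match a, b with
  | inl u, inl v => adj u v
  | inl u, inr (v, _) => u == v
  | inr (u, _), inl v => u == v
  | inr (u, x), inr (v, y) => (u == v) && adj x y
  end.

Lemma corona_adj_sym : symmetric corona_adj.
Proof.
by case=> [u|[u x]] [v|[v y]] //=; rewrite 1?eq_sym // adj_sym.
Qed.

Lemma corona_adj_irrefl : irreflexive corona_adj.
Proof. by case=> [u|[u x]] /=; rewrite adj_irrefl ?andbF. Qed.

Definition corona : sgraph := SGraph corona_adj_sym corona_adj_irrefl.

End Corona.

Section Distance.
Variable G : sgraph.

Definition walk_of_length (d : nat) (x y : G) : bool :=
  [exists p : d.-tuple G, path (@adj G) x p && (last x p == y)].

(* The least length of a walk from x to y. It is less than #|G| when x and y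
   are connected; otherwise [dist x y] takes the junk value #|G|. *)
Definition dist (x y : G) : nat :=
  find (fun d => walk_of_length d x y) (iota 0 #|G|).

(* Vertices in different components are at infinite distance. *)
Definition dist_at_most (k : nat) (x y : G) : bool :=
  connect (@adj G) x y && (dist x y <= k).

Definition distance_coloring (k : nat) (C : eqType) (f : G -> C) : bool :=
  [forall x, forall y, (x != y) && dist_at_most k x y ==> (f x != f y)].

Definition distance_colorable (k m : nat) : bool :=
  [exists f : {ffun G -> 'I_m}, distance_coloring k f].

Lemma distance_colorable_ex (k : nat) : exists m, distance_colorable k m.
Proof.
exists #|G|; apply/existsP; exists [ffun x => enum_rank x].
apply/forallP=> x; apply/forallP=> y; apply/implyP=> /andP[xy _].
by rewrite !ffunE (inj_eq enum_rank_inj).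
Qed.

Definition distance_chromatic_number (k : nat) : nat :=
  ex_minn (distance_colorable_ex k).

End Distance.

(* Main.v *)
(** The distance in [P_n ⊙ H] between vertices sitting over [i] and [j] is
    [|i - j|] plus one for each of the two that lies in a copy of [H] (as long
    as they are not in the same copy, whose diameter is at most 2).
    Put [m = min (k + 1) n].  The vertices [0, ..., m - 1] of the path together
    with the copies of [H] at [1, ..., k - 1] are pairwise at distance at most
    [k], so at least [m + (k - 1) |H|] colors are needed.  Conversely, color
    vertex [i] of the path by [i mod m], and vertex [x] of the [i]-th copy by
    the pair [(x, i mod (k - 1))], with disjoint palettes. *)
Require Import Defs.
From mathcomp Require Import all_boot.
From mathcomp Require Import zify.

Set Implicit Arguments.
Unset Strict Implicit.
Unset Printing Implicit Defensive.

Section DistAtMost.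
Variable G : sgraph.
Implicit Types (x y z : G) (d e k : nat).

Lemma dist_at_mostP k x y :
  reflect (exists p, [/\ path (@adj G) x p, last x p = y & size p <= k])
          (dist_at_most k x y).
Proof.
have walkP d : reflect (exists p, [/\ path (@adj G) x p, last x p = y
    & size p = d]) (walk_of_length d x y).
  apply: (iffP existsP) => [[p /andP[xp /eqP py]]|[p [xp py /eqP sp]]].
    by exists p; rewrite size_tuple.
  by exists (Tuple sp); rewrite /= xp py eqxx.
apply: (iffP andP) => [[/connectP[p xp py] le_k]|[p [xp py sp]]].
  have /(nth_find 0) : has (fun d => walk_of_length d x y) (iota 0 #|G|).
    (* A walk without repeated vertices has length below [#|G|], so the search over [iota 0 #|G|]
       meets it. *)
    case/shortenP: xp py => q xq uq _ qy; apply/hasP; exists (size q).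
      by rewrite mem_iota /= -[(size q).+1](card_uniqP uq) max_card.
    by apply/walkP; exists q.
  rewrite -/(dist x y) => w; have: dist x y <= #|G|.
    by rewrite -[X in _ <= X](size_iota 0) find_size.
  rewrite leq_eqVlt => /predU1P[e|lt]; last first.
    move: w; rewrite nth_iota // => /walkP[q [xq qy sq]].
    by exists q; rewrite sq.
  (* Past the end of the list [nth] returns its default 0, so [w] yields a walk of length 0, which
     is within every bound. *)
  move: w; rewrite nth_default ?size_iota ?e // => /walkP[q [xq qy sq]].
  by exists q; rewrite sq.
split; first by apply/connectP; exists p.
apply: leq_trans sp; rewrite leqNgt; apply/negP => lt.
have lt_G : size p < #|G|.
  by apply: leq_trans lt _; rewrite -[X in _ <= X](size_iota 0) find_size.
move/(before_find 0): lt; rewrite nth_iota // add0n => /walkP; apply.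
by exists p.
Qed.

Lemma dist_at_most_refl k x : dist_at_most k x x.
Proof. by apply/dist_at_mostP; exists [::]. Qed.

Lemma dist_at_most_adj x y : adj x y -> dist_at_most 1 x y.
Proof. by move=> xy; apply/dist_at_mostP; exists [:: y]; rewrite /= xy. Qed.

Lemma dist_at_most_leq d k x y :
  d <= k -> dist_at_most d x y -> dist_at_most k x y.
Proof. by move=> dk /andP[c /leq_trans/(_ dk) le_k]; rewrite /dist_at_most c. Qed.

Lemma dist_at_most_trans d e x y z :
  dist_at_most d x y -> dist_at_most e y z -> dist_at_most (d + e) x z.
Proof.
move=> /dist_at_mostP[p [xp py sp]] /dist_at_mostP[q [yq qz sq]].
apply/dist_at_mostP; exists (p ++ q).
by rewrite cat_path last_cat size_cat py xp yq leq_add.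
Qed.

Lemma dist_at_most_sym k : symmetric (@dist_at_most G k).
Proof.
suff sub x y : dist_at_most k x y -> dist_at_most k y x.
  by move=> x y; apply/idP/idP; apply: sub.
move=> /dist_at_mostP[p [xp <- sp]]; apply/dist_at_mostP.
exists (rev (belast x p)); split.
- by rewrite rev_path (eq_path (e' := @adj G)) // => u v; rewrite adj_sym.
- by case: p {xp sp} => //= z p; rewrite rev_cons last_rcons.
- by rewrite size_rev size_belast.
Qed.

(** Source of all lower bounds on distances: a function growing by at most one along each edge grows
    by at most the length of a walk. *)
Lemma dist_at_most_lipschitz (g : G -> nat) k x y :
  (forall u v, adj u v -> g v <= (g u).+1) ->
  dist_at_most k x y -> g y <= g x + k.
Proof.
move=> gP /dist_at_mostP[p [xp <- /(leq_add (leqnn (g x)))]].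
apply: leq_trans; elim: p x xp => [|z p IHp] x /=; first by rewrite addn0.
case/andP=> /gP xz /IHp zp; apply: leq_trans zp _.
by rewrite addnS -addSn leq_add2r.
Qed.

(** A coloring must be injective on the image of [g]. *)
Lemma distance_clique_leq (T : finType) (g : T -> G) k m :
  (forall s t, s != t -> (g s != g t) && dist_at_most k (g s) (g t)) ->
  distance_colorable G k m -> #|T| <= m.
Proof.
move=> gP /existsP[f /forallP fP]; rewrite -[m]card_ord.
apply: (@leq_card _ _ (f \o g)) => s t /= eq_f; apply/eqP/negPn/negP => st.
by move/forallP/(_ (g t)): (fP (g s)); rewrite (gP _ _ st) eq_f eqxx.
Qed.

Lemma distance_chromatic_number_eq k m :
  distance_colorable G k m ->
  (forall m', distance_colorable G k m' -> m <= m') ->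
  distance_chromatic_number G k = m.
Proof.
rewrite /distance_chromatic_number => col_m min_m.
case: ex_minnP => n /min_m le_mn /(_ m col_m) le_nm.
by apply/eqP; rewrite eqn_leq le_nm.
Qed.

End DistAtMost.

(** Subtraction is truncated, so the two bounds together say that the gap between [i] and [j] is
    below [m], while [m] divides it. *)
Lemma modn_inj_near m i j :
  i - j < m -> j - i < m -> i %% m = j %% m -> i = j.
Proof.
wlog le_ji : i j / j <= i => [hw|].
  by case: (leqP j i) => [/hw//|/ltnW/hw h ? ? /esym/h->].
move=> lt_m _ /eqP; rewrite eqn_mod_dvd // => /dvdn_leq; lia.
Qed.

Section PathCorona.
Variables (n : nat) (H : sgraph).
Local Notation PH := (corona (path_graph n) H).

(** Candidate closed form of the distance; one of the truncated differences is always 0, so their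
    sum is the absolute difference. Inside one copy, nonadjacent vertices are joined through the
    path vertex, at distance 2. *)
Definition corona_dist (a b : PH) : nat :=
  match a, b with
  | inl i, inl j => (i - j) + (j - i)
  | inl i, inr (j, _) => ((i - j) + (j - i)).+1
  | inr (i, _), inl j => ((i - j) + (j - i)).+1
  | inr (i, x), inr (j, y) =>
      if i == j then if x == y then 0 else (~~ adj x y).+1
      else ((i - j) + (j - i)).+2
  end.

Lemma corona_dist_adj (a b c : PH) :
  adj b c -> corona_dist a c <= (corona_dist a b).+1.
Proof.
case: a b c => [i|[i x]] [j|[j y]] [l|[l z]] //=; rewrite /path_adj.
- by lia.
- by move/eqP->.
- by move/eqP->; lia.
- by case/andP=> /eqP->; lia.
- by lia.
- move/eqP->; case: ifP => // _; case: ifP => //; case: (adj x z) => //; lia.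
- move/eqP->; case: eqP => [->|]; lia.
- case/andP=> /eqP-> yz; case: (i == l); last lia.
  case: (x =P y) => [->|_]; first by rewrite yz; case: (_ == _).
  by case: (x == z); case: (adj x z).
Qed.

Lemma corona_dist_refl (a : PH) : corona_dist a a = 0.
Proof. by case: a => [i|[i x]] /=; rewrite ?eqxx // subnn. Qed.

Lemma path_dist_at_most (i j : 'I_n) :
  dist_at_most ((i - j) + (j - i)) (inl i : PH) (inl j).
Proof.
wlog le_ij : i j / i <= j => [hw|].
  case: (leqP i j) => [/hw//|/ltnW/hw].
  by rewrite dist_at_most_sym addnC.
have -> : i - j + (j - i) = j - i by lia.
move e: (j - i) => d; elim: d j le_ij e => [|d IHd] j le_ij e.
  by have -> : i = j by [apply/val_inj => /=; lia]; apply: dist_at_most_refl.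
have lt_j : j.-1 < n by have := ltn_ord j; lia.
rewrite -addn1; apply: (@dist_at_most_trans _ _ _ _ (inl (Ordinal lt_j) : PH)).
  by apply: IHd => /=; lia.
by apply: dist_at_most_adj; rewrite /= /path_adj /=; lia.
Qed.

(** The formula is 1-Lipschitz in its second argument and vanishes on the diagonal, hence never
    exceeds the distance. Conversely, a walk of that length goes down to the path, along it and up
    again, or stays in one copy. *)
Lemma corona_dist_at_most k (a b : PH) :
  dist_at_most k a b = (corona_dist a b <= k).
Proof.
have up (i : 'I_n) x : dist_at_most 1 (inl i : PH) (inr (i, x)).
  by apply: dist_at_most_adj => /=.
have down (i : 'I_n) x : dist_at_most 1 (inr (i, x) : PH) (inl i).
  by rewrite dist_at_most_sym.
apply/idP/idP => [/(dist_at_most_lipschitz (@corona_dist_adj a))|].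
  by rewrite corona_dist_refl.
move/dist_at_most_leq; apply.
case: a b => [i|[i x]] [j|[j y]] /=.
- exact: path_dist_at_most.
- by rewrite -addn1; apply: dist_at_most_trans (path_dist_at_most _ _) (up _ _).
- by rewrite -add1n; apply: dist_at_most_trans (down _ _) (path_dist_at_most _ _).
case: (i =P j) => [<-|_]; last first.
  rewrite -add1n; apply: dist_at_most_trans (down _ _) _.
  rewrite -addn1; exact: dist_at_most_trans (path_dist_at_most _ _) (up _ _).
case: (x =P y) => [<-|_]; first exact: dist_at_most_refl.
case xy: (adj x y) => /=; last exact: dist_at_most_trans (down _ _) (up _ _).
by apply: dist_at_most_adj; rewrite /= eqxx.
Qed.

Lemma path_corona_colorable k : 2 <= k <= n ->
  distance_colorable PH k (minn k.+1 n + #|H| * (k - 1)).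
Proof.
set m := minn k.+1 n => /andP[k2 kn].
have m_gt0 : 0 < m by rewrite /m; lia.
have k1_gt0 : 0 < k - 1 by lia.
have lt_l (i : 'I_n) : i %% m < m + #|H| * (k - 1).
  by rewrite ltn_addr // ltn_mod.
(* The pair of [x] and [i] mod [k - 1] is written as a number in mixed radix, shifted by [m] past
   the palette of the path. *)
have lt_r (i : 'I_n) (x : H) :
    m + (enum_rank x * (k - 1) + i %% (k - 1)) < m + #|H| * (k - 1).
  rewrite ltn_add2l; apply: leq_trans (_ : (enum_rank x).+1 * (k - 1) <= _).
    by rewrite mulSn addnC ltn_add2r ltn_mod.
  by rewrite leq_mul2r ltn_ord orbT.
pose f (a : PH) := match a with
  | inl i => Ordinal (lt_l i) | inr (i, x) => Ordinal (lt_r i x) end.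
apply/existsP; exists [ffun a => f a].
apply/forallP => a; apply/forallP => b; apply/implyP.
rewrite !ffunE corona_dist_at_most => /andP[ab le_k]; apply: contra ab.
case: a b le_k => [i|[i x]] [j|[j y]] /= le_k /eqP[].
- move=> /modn_inj_near eq_ij; apply/eqP; congr inl; apply/val_inj.
  have lt_i := ltn_ord i; have lt_j := ltn_ord j.
  by apply: eq_ij; rewrite /m; lia.
- by have := ltn_pmod i m_gt0; lia.
- by have := ltn_pmod j m_gt0; lia.
move/addnI => eq_c.
have eq_mod : i %% (k - 1) = j %% (k - 1).
  by move/(congr1 (modn^~ (k - 1))): eq_c; rewrite !modnMDl !modn_mod.
have /enum_rank_inj eq_xy : enum_rank x = enum_rank y.
  apply/val_inj; move: eq_c; rewrite /= eq_mod => /addIn/eqP.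
  by rewrite eqn_mul2r => /orP[|/eqP //]; lia.
move: le_k; case: (i =P j) => [->|ne_ij] le_k; first by rewrite eq_xy.
(* Over distinct positions [le_k] bounds the gap by [k - 2], so residues mod [k - 1] separate
   them. *)
by case: ne_ij; apply/val_inj; apply: modn_inj_near eq_mod => /=; lia.
Qed.

Lemma path_corona_colors_leq k m : 2 <= k <= n ->
  distance_colorable PH k m -> minn k.+1 n + #|H| * (k - 1) <= m.
Proof.
case/andP=> k2 kn.
have lt_l (i : 'I_(minn k.+1 n)) : i < n by have := ltn_ord i; lia.
have lt_r (i : 'I_(k - 1)) : i.+1 < n by have := ltn_ord i; lia.
(* The shift to positions 1 to [k - 1] keeps each chosen copy within [k - 1] of both ends 0 and [k]
   of the path segment; the step into the copy brings this to [k]. *)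
pose g (t : 'I_(minn k.+1 n) + H * 'I_(k - 1)) : PH := match t with
  | inl i => inl (Ordinal (lt_l i)) | inr (x, i) => inr (Ordinal (lt_r i), x) end.
have g_inj : injective g.
  case=> [i|[x i]] [j|[y j]] //= [] => [|+ ->] => e;
  by [congr inl; apply/val_inj | congr (inr (_, _)); apply/val_inj].
move/(@distance_clique_leq PH _ g).
rewrite card_sum card_prod !card_ord; apply => s t st.
rewrite (inj_eq g_inj) st corona_dist_at_most.
case: s t {st} => [i|[x i]] [j|[y j]] /=; have := ltn_ord i; have := ltn_ord j.
- by lia.
- by lia.
- by lia.
- by case: ifP => [_|]; [case: ifP; case: (adj x y) => /=; lia | lia].
Qed.

End PathCorona.

Theorem proposition7 (H : sgraph) (n1 n2 k : nat) (hn2 : #|H| = n2)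
    (hn1 : 2 <= n1) (hk : 2 <= k <= n1) :
  (k <= n1 - 1 ->
     distance_chromatic_number (corona (path_graph n1) H) k
     = n2 * (k - 1) + k + 1)
  /\
  (k = n1 ->
     distance_chromatic_number (corona (path_graph n1) H) k
     = n2 * (k - 1) + k).
Proof.
(* Both cases are one formula: the minimum is [k + 1] if [k <= n1 - 1], and [k] if [k = n1]. *)
have -> : distance_chromatic_number (corona (path_graph n1) H) k
          = minn k.+1 n1 + #|H| * (k - 1).
  apply: distance_chromatic_number_eq (path_corona_colorable H hk) _ => m.
  exact: path_corona_colors_leq.
by rewrite hn2; split; lia.
Qed.
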